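(* Let $E,Q\in M_n(\mathbb C)$ and suppose that $E^*Q$ is either Hermitian or skew-Hermitian. Then there exist $U,V\in GL_n(\mathbb C)$ and a positive integer $f$ such that $$(UEV,U^{-*}QV)=\bigoplus_{l=1}^{f}(A_l,B_l),$$ where each $(A_l,B_l)$ is one of $(1,0)$, $(0,1)$, $(0,0)$, $(G_1^T,F_1^T)\oplus(G_0,F_0)$, or a pair $(M,N)$ of $1\times 1$ matrices with $$(M,N)\in\begin{cases}\{(1,1),(1,-1)\},&\text{if }E^*Q\text{ is Hermitian},\\ \{(1,1)\},&\text{if }E^*Q\text{ is Hermitian and positive semidefinite},\\ \{(1,i),(1,-i)\},&\text{if }E^*Q\text{ is skew-Hermitian}\end{cases}$$ (here $i=\sqrt{-1}$). This canonical form is determined uniquely by $(E,Q)$ up to a permutation of pairs of summands. Moreover, if the columns of $\begin{bmatrix}E\\Q\end{bmatrix}$ span a Lagrangian subspace of $\mathbb C^{2n}$, then only summands of the types $(1,0)$, $(0,1)$, $(M,N)$ occur.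
   Context: $M_n(\mathbb C)$ is the set of $n\times n$ complex matrices, $GL_n(\mathbb C)$ the nonsingular ones, $A^*$ is the conjugate transpose, $A^{-*}=(A^{-1})^*$. The direct sum of pairs is $(A,B)\oplus(C,D):=(A\oplus C,B\oplus D)$, where $\oplus$ on matrices is the block-diagonal direct sum. $F_k$ and $G_k$ are the $k\times(k+1)$ matrices with $F_k=[\,0\ \ I_k\,]$, $G_k=[\,I_k\ \ 0\,]$; $F_0=G_0$ is the $0\times1$ matrix, so that $(G_1^T,F_1^T)\oplus(G_0,F_0)=\left(\begin{bmatrix}1&0\\0&0\end{bmatrix},\begin{bmatrix}0&0\\1&0\end{bmatrix}\right)$. $(1,0),(0,1),(0,0)$ are pairs of $1\times1$ matrices. A Lagrangian subspace is an $n$-dimensional subspace $S\subset\mathbb C^{2n}$ such that $s^T\begin{bmatrix}0&I_n\\-I_n&0\end{bmatrix}t=0$ for all $s,t\in S$. *)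

(* Defs.v *)
From HB Require Import structures.
From mathcomp Require Import all_boot all_order all_algebra.
From mathcomp Require Import reals complex.

Set Implicit Arguments.
Unset Strict Implicit.
Unset Printing Implicit Defensive.

Import GRing.Theory Num.Theory.
Local Open Scope ring_scope.
Local Open Scope sesquilinear_scope.

(* The dimensions are part of the data, so that equality of two pairs includes
   equality of their dimensions and direct sums need no casts. *)
Definition mxpair (C : Type) : Type :=
  {d : nat * nat & ('M[C]_(d.1, d.2) * 'M[C]_(d.1, d.2))%type}.

Section MatrixPairs.
Context {C : numClosedFieldType}.

Definition mkpair m n (A B : 'M[C]_(m, n)) : mxpair C :=
  existT (fun d : nat * nat => ('M[C]_(d.1, d.2) * 'M[C]_(d.1, d.2))%type)
         (m, n) (A, B).

Definition pair11 (a b : C) : mxpair C :=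
  mkpair (a%:M : 'M_1) (b%:M : 'M_1).

Definition dsum (X Y : mxpair C) : mxpair C :=
  mkpair (block_mx (tagged X).1 0 0 (tagged Y).1)
         (block_mx (tagged X).2 0 0 (tagged Y).2).

Definition bigdsum (s : seq (mxpair C)) : mxpair C :=
  \big[dsum/mkpair (0 : 'M_(0, 0)) 0]_(X <- s) X.

Definition Fmx k : 'M[C]_(k, k.+1) := \matrix_(i, j) (j == i.+1 :> nat)%:R.
Definition Gmx k : 'M[C]_(k, k.+1) := \matrix_(i, j) (j == i :> nat)%:R.

Definition GFpair : mxpair C :=
  dsum (mkpair (Gmx 1)^T (Fmx 1)^T) (mkpair (Gmx 0) (Fmx 0)).

(* Sanity check of the conventions: the explicit 2 x 2 form of [GFpair]. *)
Lemma GFpairE :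
  GFpair = mkpair (delta_mx 0 0 : 'M_2) (delta_mx 1 0 : 'M_2).
Proof.
congr mkpair; apply/matrixP => -[[|[|//]] ?] [[|[|//]] ?]; rewrite !mxE;
  by case: splitP => -[[|[|//]] ?] //= _; rewrite mxE;
     case: splitP => -[[|[|//]] ?] //= _; rewrite ?mxE.
Qed.

Definition psdmx n (H : 'M[C]_n) : Prop :=
  H \is hermsymmx /\ forall x : 'cV[C]_n, 0 <= (x ^t* *m H *m x) 0 0.

(* [MN_set H s]: [s] lists the values allowed for (M, N) in one of the cases
   that apply to H = E^* Q.  The cases overlap (a positive semidefinite H is
   Hermitian, and 0 satisfies all three); every applicable case counts. *)
Variant MN_set n (H : 'M[C]_n) : seq (C * C) -> Prop :=
| MN_hermitian of H \is hermsymmx :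
    MN_set H [:: (1, 1); (1, -1)]
| MN_psd of psdmx H :
    MN_set H [:: (1, 1)]
| MN_skewhermitian of H \is hermitianmx n true Num.conj :
    MN_set H [:: (1, 'i); (1, - 'i)].

Definition MN_summands (MN : seq (C * C)) : seq (mxpair C) :=
  [seq pair11 p.1 p.2 | p <- MN].

Definition summand_types (MN : seq (C * C)) : seq (mxpair C) :=
  [:: pair11 1 0; pair11 0 1; pair11 0 0; GFpair] ++ MN_summands MN.

(* [s] is the list of summands of a canonical form of (E, Q). *)
Definition canonical_decomp n (MN : seq (C * C)) (E Q : 'M[C]_n)
    (s : seq (mxpair C)) : Prop :=
  [/\ (0 < size s)%N, {subset s <= summand_types MN} &
      exists U V : 'M[C]_n,
        [/\ U \in unitmx, V \in unitmx &
            mkpair (U *m E *m V) ((invmx U) ^t* *m Q *m V) = bigdsum s]].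

Definition Jmx n : 'M[C]_(n + n) := block_mx 0 1%:M (- 1%:M) 0.

Definition lagrangian n (S : {vspace 'cV[C]_(n + n)}) : Prop :=
  \dim S = n /\
  {in S &, forall s t : 'cV[C]_(n + n), s^T *m Jmx n *m t = 0}.

Definition colspan m n (A : 'M[C]_(m, n)) : {vspace 'cV[C]_m} :=
  <<[seq col j A | j <- enum 'I_n]>>%VS.

End MatrixPairs.

(* Main.v *)
(* Under (E, Q) |-> (U E V, U^-* Q V) the matrix E^* Q undergoes the congruence
   E^* Q |-> V^* E^* Q V.  Write E^* Q = mu K with |mu| = 1 and K Hermitian.

   Existence, by induction on n: if K <> 0, a vector x with x^* K x = 1 or -1
   splits off a summand (1, mu) or (1, - mu).  If E^* Q = 0, a vector killed by
   exactly one of E and Q splits off (1, 0) or (0, 1).  If E and Q have the same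
   kernel, either both vanish and (0, 0) splits off, or orthogonality of their
   images makes this kernel nontrivial, and a kernel vector together with a
   vector outside the kernel splits off (G_1^T, F_1^T) + (G_0, F_0).

   Uniqueness: n and the ranks of E, Q, E^* Q and [E; Q] determine the number of
   summands of each type, except that (1, mu) and (1, - mu) are only counted
   together; they are told apart by the inertia of K.

   A Lagrangian column span forces rank [E; Q] = n, which excludes the summands
   (0, 0) and (G_1^T, F_1^T) + (G_0, F_0), as they have a common zero column. *)
Require Import Defs.
From HB Require Import structures.
From mathcomp Require Import all_boot all_order all_algebra.
From mathcomp Require Import reals complex.
From mathcomp Require Import zify.

Set Implicit Arguments.
Unset Strict Implicit.
Unset Printing Implicit Defensive.

Import Order.TTheory GRing.Theory Num.Theory.
Local Open Scope ring_scope.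
Local Open Scope sesquilinear_scope.

(** * Adjoints, complements and the splitting of a matrix pair *)

Section Splitting.
Context {C : numClosedFieldType}.

Lemma adjM m n p (A : 'M[C]_(m, n)) (B : 'M[C]_(n, p)) :
  (A *m B) ^t* = B ^t* *m A ^t*.
Proof. by rewrite trmx_mul map_mxM. Qed.

Lemma adjK m n (A : 'M[C]_(m, n)) : A ^t* ^t* = A.
Proof. by apply/matrixP => i j; rewrite !mxE conjCK. Qed.

Lemma adj1 n : (1%:M : 'M[C]_n) ^t* = 1%:M.
Proof. by rewrite trmx1 map_mx1. Qed.

Lemma adj0 m n : (0 : 'M[C]_(m, n)) ^t* = 0.
Proof. by rewrite trmx0 map_mx0. Qed.

Lemma adj_row m n p (A : 'M[C]_(m, n)) (B : 'M[C]_(m, p)) :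
  (row_mx A B) ^t* = col_mx (A ^t*) (B ^t*).
Proof. by rewrite tr_row_mx map_col_mx. Qed.

Lemma adj_col m n p (A : 'M[C]_(m, p)) (B : 'M[C]_(n, p)) :
  (col_mx A B) ^t* = row_mx (A ^t*) (B ^t*).
Proof. by rewrite tr_col_mx map_row_mx. Qed.

Lemma adj_block m n p q (A : 'M[C]_(m, n)) (D : 'M[C]_(p, q)) :
  (block_mx A 0 0 D) ^t* = block_mx (A ^t*) 0 0 (D ^t*).
Proof. by rewrite tr_block_mx map_block_mx !trmx0 !map_mx0. Qed.

Lemma adjZ m n a (A : 'M[C]_(m, n)) : (a *: A) ^t* = a^* *: A ^t*.
Proof. by apply/matrixP => i j; rewrite !mxE rmorphM. Qed.

Lemma adjD m n (A B : 'M[C]_(m, n)) : (A + B) ^t* = A ^t* + B ^t*.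
Proof. by apply/matrixP => i j; rewrite !mxE rmorphD. Qed.

Lemma adjB m n (A B : 'M[C]_(m, n)) : (A - B) ^t* = A ^t* - B ^t*.
Proof. by apply/matrixP => i j; rewrite !mxE rmorphB. Qed.

Lemma adj_eq0 m n (A : 'M[C]_(m, n)) : (A ^t* == 0) = (A == 0).
Proof. by rewrite map_mx_eq0 trmx_eq0. Qed.

Lemma mulmx1_size m n (A : 'M[C]_(m, n)) (B : 'M[C]_(n, m)) :
  A *m B = 1%:M -> (m <= n)%N.
Proof.
move=> AB1; rewrite -[m in (m <= _)%N](mxrank1 C) -AB1.
by rewrite (leq_trans (mxrankM_maxl _ _)) ?rank_leq_col.
Qed.

Lemma full_rank_factorization m n (N : 'M[C]_(m, n)) :
  exists r (A : 'M[C]_(m, r)) (B : 'M[C]_(r, n)) (L : 'M[C]_(r, m)) (M : 'M[C]_(n, r)),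
    [/\ A *m B = N, L *m A = 1%:M & B *m M = 1%:M].
Proof.
have [L LA] := row_fullP (col_base_full N).
have [M BM] := row_freeP (row_base_free N).
by exists (\rank N), (col_base N), (row_base N), L, M; rewrite mulmx_base.
Qed.

(** [N = 1 - V R] is the projection onto the kernel of [R] along the image of [V]; the two factors
    of its full rank factorization serve as [V'] and [R']. *)
Lemma complement_mx n k (V : 'M[C]_(n, k)) (R : 'M[C]_(k, n)) :
  R *m V = 1%:M ->
  exists m (V' : 'M[C]_(n, m)) (R' : 'M[C]_(m, n)),
    [/\ n = (k + m)%N, R *m V' = 0, R' *m V = 0, R' *m V' = 1%:M
      & V *m R + V' *m R' = 1%:M].
Proof.
move=> RV; pose N := 1%:M - V *m R.
have NV : N *m V = 0 by rewrite mulmxBl mul1mx -mulmxA RV mulmx1 subrr.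
have RN : R *m N = 0 by rewrite mulmxBr mulmx1 mulmxA RV mul1mx subrr.
have NN : N *m N = N by rewrite {1}/N mulmxBl mul1mx -mulmxA RN mulmx0 subr0.
have [r [A [B [L [M [AB LA BM]]]]]] := full_rank_factorization N.
have BV : B *m V = 0 by rewrite -[B]mul1mx -LA -!mulmxA (mulmxA A) AB NV mulmx0.
have RA : R *m A = 0 by rewrite -[A]mulmx1 -BM (mulmxA A) AB mulmxA RN mul0mx.
(* Idempotence reads [A B A B = A B]; the left inverse of [A] and the right inverse of [B] cancel
   the outer factors. *)
have BA : B *m A = 1%:M.
  have : L *m (N *m N) *m M = L *m N *m M by rewrite NN.
  rewrite -AB !mulmxA LA !mul1mx -(mulmxA _ B M) BM mulmx1; exact.
have VR1 : V *m R + A *m B = 1%:M by rewrite AB addrC subrK.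
exists r, A, B; split=> //.
apply/eqP; rewrite eqn_leq; apply/andP; split.
  apply: (@mulmx1_size _ _ (row_mx V A) (col_mx R B)).
  by rewrite mul_row_col.
apply: (@mulmx1_size _ _ (col_mx R B) (row_mx V A)).
by rewrite mul_col_row RV RA BV BA -scalar_mx_block.
Qed.

Lemma mkpair_inj m n (A B A' B' : 'M[C]_(m, n)) :
  mkpair A B = mkpair A' B' -> A = A' /\ B = B'.
Proof. by move/eqP; rewrite eq_Tagged /= xpair_eqE => /andP[/eqP-> /eqP->]. Qed.

Lemma mul_diag_block m n p m' n' p' (A : 'M[C]_(m, n)) (B : 'M[C]_(n, p))
    (A' : 'M[C]_(m', n')) (B' : 'M[C]_(n', p')) :
  block_mx A 0 0 A' *m block_mx B 0 0 B' = block_mx (A *m B) 0 0 (A' *m B').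
Proof. by rewrite mulmx_block !mulmx0 !mul0mx !addr0 !add0r. Qed.

(** The inverses of [U] and [V] are carried as witnesses [T] and [R], so that block computations
    never meet [invmx]. *)
Definition equivalent n (E Q : 'M[C]_n) (X : mxpair C) : Prop :=
  exists U T V R : 'M[C]_n,
    [/\ U *m T = 1%:M, V *m R = 1%:M
      & mkpair (U *m E *m V) (T ^t* *m Q *m V) = X].

Lemma equivalentP n (E Q : 'M[C]_n) (X : mxpair C) :
  equivalent E Q X <->
  exists U V : 'M[C]_n,
    [/\ U \in unitmx, V \in unitmx
      & mkpair (U *m E *m V) ((invmx U) ^t* *m Q *m V) = X].
Proof.
split=> [[U [T [V [R [UT VR <-]]]]]|[U [V [uU uV <-]]]].
  have [[uU _] [uV _]] := (mulmx1_unit UT, mulmx1_unit VR).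
  exists U, V; split=> //; congr (mkpair _ (_ ^t* *m _ *m _)).
  by rewrite -[LHS]mulmx1 -UT mulmxA mulVmx ?mul1mx.
by exists U, (invmx U), V, (invmx V); rewrite !mulmxV.
Qed.

Lemma equivalent_dsum k m (E Q : 'M[C]_(k + m)) (E0 Q0 : 'M[C]_k) (E' Q' : 'M[C]_m)
    (X : mxpair C) :
  equivalent E Q (dsum (mkpair E0 Q0) (mkpair E' Q')) -> equivalent E' Q' X ->
  equivalent E Q (dsum (mkpair E0 Q0) X).
Proof.
move=> [U [T [V [R [UT VR /mkpair_inj[/= UEV TQV]]]]]].
move=> [U' [T' [V' [R' [UT' VR' <-]]]]].
exists (block_mx 1%:M 0 0 U' *m U), (T *m block_mx 1%:M 0 0 T').
exists (V *m block_mx 1%:M 0 0 V'), (block_mx 1%:M 0 0 R' *m R).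
split.
- rewrite mulmxA -(mulmxA _ U) UT mulmx1 mul_diag_block UT' mulmx1.
  by rewrite -scalar_mx_block.
- rewrite mulmxA -(mulmxA V) mul_diag_block VR' mulmx1.
  by rewrite -scalar_mx_block mulmx1.
congr mkpair.
  rewrite -(mulmxA _ U) (mulmxA _ V) -(mulmxA _ _ V) UEV /=.
  by rewrite !mul_diag_block mul1mx mulmx1.
rewrite adjM adj_block adj1 -(mulmxA _ (T ^t*)) (mulmxA _ V) -(mulmxA _ _ V).
by rewrite TQV /= !mul_diag_block mul1mx mulmx1.
Qed.

(* [V0] and [T0] embed the pair [(E0, Q0)] in [(E, Q)], and the last four
   equations make the kernels of the retractions [R0] and [S0] a complementary
   pair of subspaces. *)
Definition embeds n k (E Q : 'M[C]_n) (E0 Q0 : 'M[C]_k) : Prop :=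
  exists (V0 T0 : 'M[C]_(n, k)) (R0 S0 : 'M[C]_(k, n)),
    [/\ R0 *m V0 = 1%:M /\ S0 *m T0 = 1%:M,
        E *m V0 = T0 *m E0, S0 *m E = E0 *m R0,
        T0 ^t* *m Q = Q0 *m R0 & Q *m V0 = S0 ^t* *m Q0].

(** In the bases [[V0 V']] and [[T0 T']] the equations of [embeds] annihilate the off-diagonal
    blocks. The formula for [E'^* Q'] passes the hypotheses on [E^* Q] to the remaining pair. *)
Lemma pair_splitting n k (E Q : 'M[C]_n) (E0 Q0 : 'M[C]_k) :
  embeds E Q E0 Q0 ->
  exists m (E' Q' : 'M[C]_m) (W : 'M[C]_(n, m)),
    [/\ n = (k + m)%N, E' ^t* *m Q' = W ^t* *m (E ^t* *m Q) *m W
      & equivalent E Q (dsum (mkpair E0 Q0) (mkpair E' Q'))].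
Proof.
move=> [V0 [T0 [R0 [S0 [[RV ST] EV SE TQ QV]]]]].
have [m [V' [R' [def_n RV' R'V R'V' VR]]]] := complement_mx RV.
have [m' [T' [S' [def_n' ST' S'T S'T' TS]]]] := complement_mx ST.
(* Both complements have dimension [n - k]; identifying the two sizes makes the remaining pair
   square. *)
have eq_m : m' = m by apply: (@addnI k); rewrite -def_n.
subst m'; clear def_n'.
subst n.
exists m, (S' *m E *m V'), (T' ^t* *m Q *m V'), V'.
pose U := col_mx S0 S'; pose T := row_mx T0 T'.
pose V := row_mx V0 V'; pose R := col_mx R0 R'.
have UT : U *m T = 1%:M by rewrite mul_col_row ST ST' S'T S'T' -scalar_mx_block.
have VR1 : V *m R = 1%:M by rewrite mul_row_col.
split=> //.
  rewrite !adjM -!mulmxA (mulmxA (S' ^t*)) -adjM.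
  (* [T' S'] differs from the identity by [T0 S0], whose contribution contains
     [T0^* Q V' = Q0 R0 V' = 0]. *)
  have -> : T' *m S' = 1%:M - T0 *m S0 by rewrite -TS addrAC subrr add0r.
  have -> : ((1%:M - T0 *m S0) ^t*) *m (Q *m V') = Q *m V'; last by [].
  rewrite adjB mulmxBl adj1 mul1mx adjM -!mulmxA (mulmxA (T0 ^t*)).
  by rewrite TQ -mulmxA RV' !mulmx0 subr0.
exists U, T, V, R; split=> //; congr mkpair.
  rewrite !mul_col_mx !mul_mx_row SE -(mulmxA _ E V0) EV -!mulmxA RV RV' (mulmxA S') S'T.
  by rewrite mulmx1 mulmx0 mul0mx /= -block_mxEv.
rewrite /= adj_row !mul_col_mx !mul_mx_row -block_mxEv TQ -(mulmxA _ R0) RV.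
rewrite -(mulmxA _ R0) RV' -(mulmxA _ Q V0) QV (mulmxA (T' ^t*)).
have -> : T' ^t* *m S0 ^t* = 0 by rewrite -adjM ST' adj0.
by rewrite mulmx1 mulmx0 mul0mx.
Qed.

End Splitting.

(** * Existence: embedded summands and induction on the size *)

Section Existence.
Context {C : numClosedFieldType}.

Lemma cV_left_inverse n (v : 'cV[C]_n) :
  v != 0 -> exists s : 'rV[C]_n, s *m v = 1%:M.
Proof.
by move=> nzv; apply/row_fullP; rewrite /row_full -mxrank_tr rank_rV trmx_eq0 nzv.
Qed.

Lemma rV_right_inverse n (v : 'rV[C]_n) :
  v != 0 -> exists t : 'cV[C]_n, v *m t = 1%:M.
Proof. by move=> nzv; apply/row_freeP; rewrite /row_free rank_rV nzv. Qed.

Lemma col_neq0 m n (A : 'M[C]_(m, n)) : A != 0 -> exists j, col j A != 0.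
Proof.
move=> nzA; apply/existsP; apply: contraNT nzA; rewrite negb_exists => /forallP z.
apply/eqP/matrixP => i j; have := z j; rewrite negbK => /eqP/matrixP/(_ i 0).
by rewrite !mxE.
Qed.

Lemma quadratic_form_neq0 n (K : 'M[C]_n) :
  K != 0 -> exists x : 'cV[C]_n, x ^t* *m K *m x != 0.
Proof.
have polar (x y : 'cV[C]_n) : x ^t* *m K *m y != 0 ->
    exists z : 'cV[C]_n, z ^t* *m K *m z != 0.
  move=> bxy.
  have [qx|] := eqVneq (x ^t* *m K *m x) 0; last by exists x.
  have [qy|] := eqVneq (y ^t* *m K *m y) 0; last by exists y.
  have [qxy|] := eqVneq ((x + y) ^t* *m K *m (x + y)) 0; last by exists (x + y).
  have [qxiy|] := eqVneq ((x + 'i *: y) ^t* *m K *m (x + 'i *: y)) 0;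
    last by exists (x + 'i *: y).
  (* Polarization: vanishing at [x + y] gives [x^* K y = - y^* K x], and vanishing at [x + i y]
     gives [x^* K y = y^* K x], so both are 0. *)
  move: qxy qxiy; rewrite !adjD !mulmxDl !mulmxDr adjZ.
  rewrite -!scalemxAl -!scalemxAr qx qy !scaler0 !addr0 !add0r conjCi.
  move=> /eqP; rewrite addr_eq0 => /eqP bE; rewrite bE => /eqP.
  rewrite scalerN scaleNr -opprD oppr_eq0 -mulr2n -scaler_nat scalerA scaler_eq0.
  rewrite mulf_eq0 pnatr_eq0 (negPf (neq0Ci C)) /= => /eqP bxy0.
  by move: bxy; rewrite bE bxy0 oppr0 eqxx.
move=> /eqP nzK.
have [/existsP[i /existsP[j Kij]]|] := boolP [exists i, exists j, K i j != 0].
  apply: (polar (delta_mx i 0) (delta_mx j 0)).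
  rewrite trmx_delta map_delta_mx -rowE -colE.
  by apply: contraNneq Kij => /matrixP/(_ 0 0); rewrite !mxE => ->.
rewrite negb_exists => /forallP K0; case: nzK; apply/matrixP => i j.
by have := K0 i; rewrite negb_exists => /forallP/(_ j); rewrite negbK mxE => /eqP.
Qed.

Lemma quadratic_form_sign n (K : 'M[C]_n) : K ^t* = K -> K != 0 ->
  exists (x : 'cV[C]_n) (b : bool), x ^t* *m K *m x = ((-1) ^+ b)%:M.
Proof.
move=> hK /quadratic_form_neq0[x]; set q := x ^t* *m K *m x => nzq.
pose c := q 0 0.
have qE : q = c%:M by rewrite [LHS]mx11_scalar.
have nzc : c != 0.
  by apply: contraNneq nzq => c0; rewrite qE c0 raddf0.
have cR : c \is Num.real.
  apply/CrealP; have : q ^t* = q by rewrite /q !adjM adjK hK mulmxA.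
  by rewrite qE => /matrixP/(_ 0 0); rewrite mxE mxE [c%:M 0 0]mxE eqxx mulr1n.
have tR : (sqrtC `|c|)^-1^* = (sqrtC `|c|)^-1.
  by apply/CrealP; rewrite rpredV ger0_real // sqrtC_ge0.
(* The rescaling turns the real nonzero value [c] into [c / |c|], the sign recorded by the
   boolean. *)
exists ((sqrtC `|c|)^-1 *: x), (c < 0).
rewrite adjZ -!scalemxAl -!scalemxAr -/q qE -!mul_scalar_mx -!scalar_mxM tR.
rewrite mulrA -invfM -expr2 sqrtCK; congr (_%:M).
by rewrite mulrC {1}[c]realEsign // mulfK // normr_eq0.
Qed.

(** The complements are the [K]-orthogonal of [x] in the source and the orthogonal of [Q x] in the
    target. The factor [sg * mu] normalizes the second retraction, since [x^* Q^* E x = mu^* sg]. *)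
Lemma embeds_definite n (E Q K : 'M[C]_n) (mu sg : C) (x : 'cV[C]_n) :
    mu * mu^* = 1 -> sg * sg = 1 -> sg^* = sg ->
    K ^t* = K -> E ^t* *m Q = mu *: K -> x ^t* *m K *m x = sg%:M ->
  embeds E Q (1%:M : 'M_1) (sg * mu)%:M.
Proof.
move=> mu1 sg1 sgR hK EQ xKx.
have QE : Q ^t* *m E = mu^* *: K by rewrite -[E]adjK -adjM EQ adjZ hK.
exists x, (E *m x), (sg *: (x ^t* *m K)), ((sg * mu) *: (x ^t* *m Q ^t*)).
have SE : (sg * mu) *: (x ^t* *m Q ^t*) *m E = sg *: (x ^t* *m K).
  by rewrite -scalemxAl -mulmxA QE -scalemxAr scalerA -mulrA mu1 mulr1.
have RV : sg *: (x ^t* *m K) *m x = 1%:M.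
  by rewrite -scalemxAl xKx -mul_scalar_mx -scalar_mxM sg1.
split.
- by rewrite mulmxA SE RV.
- by rewrite mulmx1.
- by rewrite SE mul1mx.
- by rewrite mul_scalar_mx scalerA mulrAC sg1 mul1r adjM -mulmxA EQ scalemxAr.
- rewrite adjZ adjM !adjK mul_mx_scalar scalerA rmorphM /= sgR.
  by rewrite mulrACA sg1 mul1r mu1 scale1r.
Qed.

Lemma embeds_left n (E Q : 'M[C]_n) (y : 'cV[C]_n) :
    E ^t* *m Q = 0 -> E *m y != 0 -> Q *m y = 0 ->
  embeds E Q (1%:M : 'M_1) 0%:M.
Proof.
move=> EQ /cV_left_inverse[s sEy] Qy.
exists y, (E *m y), (s *m E), s; split.
- by rewrite -mulmxA sEy.
- by rewrite mulmx1.
- by rewrite mul1mx.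
- by rewrite adjM -mulmxA EQ mulmx0 raddf0 mul0mx.
- by rewrite Qy raddf0 mulmx0.
Qed.

(** Dual to [embeds_left]: exchanging [E] and [Q] exchanges [U] and [U^-*], so [Q y] now defines the
    retraction [S0], while a vector [t] with [(Q y)^* t = 1] plays the part of [T0]. *)
Lemma embeds_right n (E Q : 'M[C]_n) (y : 'cV[C]_n) :
    E ^t* *m Q = 0 -> E *m y = 0 -> Q *m y != 0 ->
  embeds E Q (0%:M : 'M_1) 1%:M.
Proof.
move=> EQ Ey; rewrite -adj_eq0 => /rV_right_inverse[t Qyt].
exists y, t, (t ^t* *m Q), ((Q *m y) ^t*); split.
- by split=> //; rewrite -mulmxA -[Q *m y]adjK -adjM Qyt adj1.
- by rewrite Ey raddf0 mulmx0.
- by rewrite adjM -mulmxA -[E]adjK -adjM EQ adj0 mulmx0 raddf0 mul0mx.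
- by rewrite mul1mx.
- by rewrite adjK mulmx1.
Qed.

Lemma embeds_zero n : (0 < n)%N ->
  embeds (0 : 'M[C]_n) 0 (0%:M : 'M_1) 0%:M.
Proof.
case: n => // n _.
have R1 : (delta_mx 0 0 : 'rV[C]_n.+1) *m (delta_mx 0 0 : 'cV[C]_n.+1) = 1%:M.
  rewrite mul_delta_mx; apply/matrixP => i j.
  by rewrite !ord1 !mxE.
exists (delta_mx 0 0), (delta_mx 0 0), (delta_mx 0 0), (delta_mx 0 0).
by split; rewrite ?raddf0 ?mul0mx ?mulmx0.
Qed.

Lemma GFpair_block :
  GFpair = mkpair (block_mx (1%:M : 'M[C]_1) 0 0 (0 : 'M_1)) (block_mx 0 0 1%:M 0).
Proof.
rewrite GFpairE; congr mkpair; apply/matrixP => -[[|[|//]] ?] [[|[|//]] ?];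
  rewrite !mxE; by case: splitP => -[[|[|//]] ?] //= _; rewrite mxE;
     case: splitP => -[[|[|//]] ?] //= _; rewrite ?mxE.
Qed.

(** The source basis is [x, k] with [k] in the common kernel; the target basis is [z, w] with
    [z = E x] and [w] dual to [Q x]. The inclusions of row spaces say that the kernels agree. *)
Lemma embeds_GF n (E Q : 'M[C]_n) :
    E ^t* *m Q = 0 -> E != 0 -> (E <= Q)%MS -> (Q <= E)%MS ->
  embeds E Q (block_mx (1%:M : 'M_1) 0 0 (0 : 'M_1)) (block_mx 0 0 1%:M 0).
Proof.
move=> EQ nzE sEQ sQE.
have QE : Q ^t* *m E = 0 by rewrite -[E]adjK -adjM EQ adj0.
have [k nzk Ek] : exists2 k : 'cV[C]_n, k != 0 & E *m k = 0.
  (* Were [E] invertible, [E^* Q = 0] would force [Q = 0], and then [E = 0] by the inclusion of row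
     spaces. *)
  have : cokermx E != 0.
    apply: contra nzE => coE0.
    have uE : row_full E by rewrite -cokermx_eq0.
    have [L LE] := row_fullP uE.
    have Q0 : Q = 0.
      by rewrite -[Q]mul1mx -adj1 -(mulmx1C LE) adjM -mulmxA EQ mulmx0.
    by move: sEQ; rewrite Q0 submx0.
  move/col_neq0=> [j nzj].
  by exists (col j (cokermx E)) => //; rewrite colE mulmxA mulmx_coker mul0mx.
have Qk : Q *m k = 0.
  by have /submxP[D ->] := sQE; rewrite -mulmxA Ek mulmx0.
have [x nzEx] : exists x : 'cV[C]_n, E *m x != 0.
  have [j nzj] := col_neq0 nzE.
  by exists (delta_mx j 0); rewrite -colE.
pose z := E *m x; have [s sz] : exists s : 'rV_n, s *m z = 1%:M := cV_left_inverse nzEx.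
have [t tk] := cV_left_inverse nzk.
have /submxP[w0 sEw] : (s *m E <= Q)%MS by rewrite (submx_trans _ sEQ) ?submxMl.
pose r := s *m E.
(* The multiple of [z] is subtracted to obtain [s w = 0]; it leaves [w^* Q = r] intact because
   [z^* Q = 0]. *)
pose w := w0 ^t* - z *m (s *m w0 ^t*).
have zQ : z ^t* *m Q = 0 by rewrite adjM -mulmxA EQ mulmx0.
have wQ : w ^t* *m Q = r.
  rewrite /w adjB mulmxBl adjK adjM -(mulmxA _ _ Q) zQ mulmx0 subr0.
  by rewrite -sEw.
have sw : s *m w = 0 by rewrite mulmxBr (mulmxA s z) sz mul1mx subrr.
have rx : r *m x = 1%:M by rewrite -mulmxA.
have rk : r *m k = 0 by rewrite -mulmxA Ek mulmx0.
have Qxz : (Q *m x) ^t* *m z = 0 by rewrite adjM -mulmxA (mulmxA _ E) QE mul0mx mulmx0.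
have Qxw : (Q *m x) ^t* *m w = 1%:M.
  by rewrite -[w]adjK -adjM mulmxA wQ rx adj1.
(* Correcting [t] by a multiple of [r] makes it vanish on [x] and keeps the value 1 on [k], as
   [r k = 0]. *)
pose r' := t - t *m x *m r.
have r'x : r' *m x = 0 by rewrite mulmxBl -(mulmxA _ r) rx mulmx1 subrr.
have r'k : r' *m k = 1%:M by rewrite mulmxBl -(mulmxA _ r) rk mulmx0 subr0.
exists (row_mx x k), (row_mx z w), (col_mx r r'), (col_mx s ((Q *m x) ^t*)); split.
- rewrite !mul_col_row rx rk r'x r'k sz sw Qxz Qxw; split; by rewrite -scalar_mx_block.
- by rewrite mul_mx_row Ek mul_row_block !mulmx0 mulmx1 !addr0.
- by rewrite mul_col_mx mul_block_col adjM -!mulmxA QE mulmx0 !mul0mx mul1mx !addr0.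
- by rewrite adj_row mul_col_mx zQ wQ mul_block_col !mul0mx mul1mx !addr0.
- by rewrite mul_mx_row Qk adj_col mul_row_block adjK !mulmx0 mulmx1 !addr0 add0r.
Qed.

Lemma embeds_summand (MN : seq (C * C)) (mu : C) n (E Q K : 'M[C]_n) :
    (0 < n)%N -> mu * mu^* = 1 -> K ^t* = K -> E ^t* *m Q = mu *: K ->
    (1, mu) \in MN ->
    (1, - mu) \in MN \/ (forall x : 'cV_n, 0 <= (x ^t* *m K *m x) 0 0) ->
  exists k (E0 Q0 : 'M[C]_k),
    [/\ (0 < k)%N, mkpair E0 Q0 \in summand_types MN & embeds E Q E0 Q0].
Proof.
move=> n_gt0 mu1 hK EQ MNp MNn.
have MNP (a b : C) : (a, b) \in MN -> pair11 a b \in summand_types MN.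
  by move=> ab; rewrite mem_cat (map_f _ ab) orbT.
have [K0|nzK] := eqVneq K 0; last first.
  have [x [b xKx]] := quadratic_form_sign hK nzK.
  exists 1%N, 1%:M, ((-1) ^+ b * mu)%:M; split=> //; last first.
    apply: (embeds_definite (x := x) mu1 _ _ hK EQ) => //.
      by rewrite -expr2 sqrr_sign.
    by rewrite rmorph_sign.
  (* The value -1 requires [(1, - mu)]; either it is allowed, or nonnegativity of [K] rules this
     value out. *)
  apply: MNP; case: b xKx => xKx; last by rewrite expr0 mul1r.
  rewrite expr1 mulN1r; case: MNn => // /(_ x).
  by rewrite xKx mxE eqxx mulr1n expr1 oppr_ge0 ler10.
have {EQ} EQ : E ^t* *m Q = 0 by rewrite EQ K0 scaler0.
have [sEQ|] := boolP (E <= Q)%MS; last first.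
  (* Some column of [cokermx Q] is killed by [Q] but not by [E]. *)
  rewrite submxE => /col_neq0[j]; rewrite colE -mulmxA -colE => nzEy.
  exists 1%N, 1%:M, 0%:M; split; rewrite ?in_cons ?eqxx //.
  by apply: (embeds_left EQ nzEy); rewrite colE mulmxA mulmx_coker mul0mx.
have [sQE|] := boolP (Q <= E)%MS; last first.
  rewrite submxE => /col_neq0[j]; rewrite colE -mulmxA -colE => nzQy.
  exists 1%N, 0%:M, 1%:M; split; rewrite ?in_cons ?eqxx ?orbT //.
  by apply: (embeds_right EQ _ nzQy); rewrite colE mulmxA mulmx_coker mul0mx.
have [E0|nzE] := eqVneq E 0.
  have Q0 : Q = 0 by apply/eqP; rewrite -submx0 -E0.
  exists 1%N, 0%:M, 0%:M; split; first by [].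
    rewrite mem_cat; apply/orP; left.
    exact: (@mem_nth _ (pair11 0 0) [:: pair11 1 0; pair11 0 1; pair11 0 0; GFpair] 2).
  by rewrite E0 Q0; apply: embeds_zero.
do 3!eexists; split; last exact: (embeds_GF EQ nzE sEQ sQE); first by [].
by rewrite -GFpair_block !in_cons eqxx !orbT.
Qed.

(** The induction is strong because the split summand may have size 1 or 2. Hermitian symmetry and
    nonnegativity both survive the passage from [K] to [W^* K W]. *)
Lemma canonical_form_exists (MN : seq (C * C)) (mu : C) n (E Q K : 'M[C]_n) :
    mu * mu^* = 1 -> K ^t* = K -> E ^t* *m Q = mu *: K ->
    (1, mu) \in MN ->
    (1, - mu) \in MN \/ (forall x : 'cV_n, 0 <= (x ^t* *m K *m x) 0 0) ->
  exists2 s, {subset s <= summand_types MN} & equivalent E Q (bigdsum s).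
Proof.
move=> mu1 + + MNp; elim/ltn_ind: n => n IHn in E Q K *.
have [n0 hK EQ MNn|n_gt0 hK EQ MNn] := posnP n.
  subst n; exists [::] => //; exists 1%:M, 1%:M, 1%:M, 1%:M.
  by rewrite /bigdsum big_nil !mulmx1; split=> //; congr mkpair; apply: flatmx0.
have [k [E0 [Q0 [k_gt0 typ emb]]]] := embeds_summand n_gt0 mu1 hK EQ MNp MNn.
have [m [E' [Q' [W [def_n EQ' eqv]]]]] := pair_splitting emb.
have lt_mn : (m < n)%N by rewrite def_n -[X in (X < _)%N]add0n ltn_add2r.
have [||| s sMN eqv'] := IHn m lt_mn E' Q' (W ^t* *m K *m W).
- by rewrite !adjM adjK hK mulmxA.
- by rewrite EQ' EQ -scalemxAr -scalemxAl.
- case: MNn => [|K_ge0]; [by left | right=> x].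
  by have := K_ge0 (W *m x); rewrite adjM !mulmxA.
exists (mkpair E0 Q0 :: s).
  by move=> X; rewrite in_cons => /predU1P[->|/sMN].
subst n; rewrite /bigdsum big_cons; exact: equivalent_dsum eqv eqv'.
Qed.

End Existence.

(** * Uniqueness: rank invariants additive under direct sums *)

Lemma sum_by_values (T : eqType) (ts s : seq T) (f : T -> nat) :
  uniq ts -> {subset s <= ts} ->
  (\sum_(x <- s) f x = \sum_(t <- ts) count_mem t s * f t)%N.
Proof.
move=> uts; elim: s => [|x s IHs] sub.
  by rewrite big_nil big1_seq.
rewrite big_cons IHs; last by move=> y ys; rewrite sub // in_cons ys orbT.
under [RHS]eq_bigr do rewrite /= mulnDl.
rewrite big_split /=; congr (_ + _)%N.
rewrite (bigD1_seq x) ?sub ?mem_head //= eqxx mul1n big1 ?addn0 // => t.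
by rewrite eq_sym => /negPf->.
Qed.

Section Uniqueness.
Context {C : numClosedFieldType}.

Lemma big_bigdsum (f : mxpair C -> nat) :
    f (mkpair (0 : 'M_(0, 0)) 0) = 0%N ->
    (forall X Y, f (dsum X Y) = f X + f Y)%N ->
  forall s, f (bigdsum s) = (\sum_(X <- s) f X)%N.
Proof. by move=> f0 fD s; rewrite /bigdsum; elim/big_rec2: _ => // X _ Y _ <-. Qed.

Definition gram (X : mxpair C) : 'M[C]_((tag X).2) :=
  (tagged X).1 ^t* *m (tagged X).2.

Definition rankE (X : mxpair C) := \rank (tagged X).1.
Definition rankQ (X : mxpair C) := \rank (tagged X).2.
Definition rankEQ (X : mxpair C) := \rank (col_mx (tagged X).1 (tagged X).2).
Definition rankG (X : mxpair C) := \rank (gram X).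
Definition ncols (X : mxpair C) := (tag X).2.

Lemma gram_dsum X Y : gram (dsum X Y) = block_mx (gram X) 0 0 (gram Y).
Proof. by rewrite /gram /= adj_block mul_diag_block. Qed.

(** The two sides come from matrices with the same rows in a different order; mutual inclusion of
    row spaces replaces an explicit permutation. *)
Lemma rank_col_diag_block m m' n n' p p' (A : 'M[C]_(m, n)) (A' : 'M[C]_(m', n'))
    (B : 'M[C]_(p, n)) (B' : 'M[C]_(p', n')) :
  \rank (col_mx (block_mx A 0 0 A') (block_mx B 0 0 B'))
  = (\rank (col_mx A B) + \rank (col_mx A' B'))%N.
Proof.
rewrite -rank_diag_block_mx !block_mxEv.
have row0 r r' k l (L : 'M[C]_(r, k)) (M : 'M_(r', k)) :
    row_mx (col_mx L M) 0 = col_mx (row_mx L (0 : 'M_(r, l))) (row_mx M 0).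
  by rewrite -[X in row_mx _ X = _]col_mx0 -block_mxEh block_mxEv.
have row0' r r' k l (L : 'M[C]_(r, k)) (M : 'M_(r', k)) :
    row_mx 0 (col_mx L M) = col_mx (row_mx (0 : 'M_(r, l)) L) (row_mx 0 M).
  by rewrite -[X in row_mx X _ = _]col_mx0 -block_mxEh block_mxEv.
rewrite row0 row0'; apply/eqP; rewrite eqn_leq.
have up r r' r'' k (L : 'M[C]_(r, k)) (M : 'M_(r', k)) (N : 'M_(r'', k)) :
    (L <= M)%MS -> (L <= col_mx M N)%MS.
  by move=> sAM; rewrite -addsmxE (submx_trans sAM) ?addsmxSl.
have dn r r' r'' k (L : 'M[C]_(r, k)) (M : 'M_(r', k)) (N : 'M_(r'', k)) :
    (L <= N)%MS -> (L <= col_mx M N)%MS.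
  by move=> sAN; rewrite -addsmxE (submx_trans sAN) ?addsmxSr.
have refl := @submx_refl C.
by rewrite !mxrankS // !col_mx_sub; do !(apply/andP; split); auto.
Qed.

Lemma rankEQ_bigdsum s : rankEQ (bigdsum s) = (\sum_(X <- s) rankEQ X)%N.
Proof.
apply: big_bigdsum => [|X Y]; first by rewrite /rankEQ col_mx0 mxrank0.
exact: rank_col_diag_block.
Qed.

Lemma rankE_bigdsum s : rankE (bigdsum s) = (\sum_(X <- s) rankE X)%N.
Proof.
by apply: big_bigdsum => [|X Y]; rewrite /rankE ?mxrank0 ?rank_diag_block_mx.
Qed.

Lemma rankQ_bigdsum s : rankQ (bigdsum s) = (\sum_(X <- s) rankQ X)%N.
Proof.
by apply: big_bigdsum => [|X Y]; rewrite /rankQ ?mxrank0 ?rank_diag_block_mx.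
Qed.

Lemma rankG_bigdsum s : rankG (bigdsum s) = (\sum_(X <- s) rankG X)%N.
Proof.
apply: big_bigdsum => [|X Y]; first by rewrite /rankG /gram mulmx0 mxrank0.
by rewrite /rankG gram_dsum rank_diag_block_mx.
Qed.

Lemma ncols_bigdsum s : ncols (bigdsum s) = (\sum_(X <- s) ncols X)%N.
Proof. exact: big_bigdsum. Qed.

(** * Inertia of forms *)

Definition form n (K : 'M[C]_n) (w : 'rV[C]_n) : C := (w *m K *m w ^t*) 0 0.

Lemma form_block n n' (K : 'M[C]_n) (K' : 'M[C]_n') w w' :
  form (block_mx K 0 0 K') (row_mx w w') = form K w + form K' w'.
Proof.
rewrite /form mul_row_block !mulmx0 addr0 add0r adj_row mul_row_col.
by rewrite mxE.
Qed.

(* Inertia by witnessing subspaces rather than by diagonalization, so that it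
   is visibly additive under direct sums; [P] needs no rank hypothesis, since
   definiteness makes its rows independent. *)
Definition inertia_cert n (K : 'M[C]_n) p q : Prop :=
  exists (P : 'M[C]_(p, n)) (N : 'M[C]_(q, n)),
    [/\ row_free N, forall v, v != 0 -> 0 < form K (v *m P)
      & forall v, form K (v *m N) <= 0].

(** Core of Sylvester's law of inertia: a positive definite subspace meets a nonpositive one only in
    0, so their dimensions add up to at most [n]. *)
Lemma inertia_cert_leq n (K : 'M[C]_n) p q p' q' :
  inertia_cert K p q -> inertia_cert K p' q' -> (p + q' <= n)%N.
Proof.
move=> [P [_ [_ Ppos _]]] [_ [N [Nfree _ Nneg]]].
have Pfree : row_free P.
  apply: inj_row_free => v vP0; apply/eqP; apply: contraT => /Ppos.
  by rewrite vP0 /form !mul0mx mxE ltxx.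
have cap0 : \rank (P :&: N)%MS = 0%N.
  apply/eqP; rewrite mxrank_eq0; apply/negPn/negP => /rowV0Pn[w].
  rewrite sub_capmx => /andP[/submxP[v wP] /submxP[u wN]] nzw.
  have nzv : v != 0 by apply: contraNneq nzw => v0; rewrite wP v0 mul0mx.
  have := lt_le_trans (Ppos v nzv); rewrite -wP wN => /(_ _ (Nneg u)).
  by rewrite ltxx.
have := mxrank_sum_cap P N; rewrite cap0 addn0.
move: Pfree Nfree; rewrite /row_free => /eqP-> /eqP-> <-.
exact: rank_leq_col.
Qed.

Lemma inertia_cert_congr n (K V R : 'M[C]_n) p q : V *m R = 1%:M ->
  inertia_cert (V ^t* *m K *m V) p q -> inertia_cert K p q.
Proof.
move=> VR [P [N [Nfree Ppos Nneg]]].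
have formV w : form (V ^t* *m K *m V) w = form K (w *m V ^t*).
  by rewrite /form adjM adjK !mulmxA.
exists (P *m V ^t*), (N *m V ^t*); split.
- have uV : row_free (V ^t*).
    by rewrite row_free_unit map_unitmx unitmx_tr; case: (mulmx1_unit VR).
  by rewrite /row_free mxrankMfree.
- by move=> v /Ppos; rewrite formV mulmxA.
- by move=> v; rewrite mulmxA -formV.
Qed.

Lemma inertia_cert_block n n' (K : 'M[C]_n) (K' : 'M[C]_n') p q p' q' :
  inertia_cert K p q -> inertia_cert K' p' q' ->
  inertia_cert (block_mx K 0 0 K') (p + p') (q + q').
Proof.
move=> [P [N [Nfree Ppos Nneg]]] [P' [N' [Nfree' Ppos' Nneg']]].
have formM r r' (A : 'M_(r, n)) (A' : 'M_(r', n')) v :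
    form (block_mx K 0 0 K') (v *m block_mx A 0 0 A')
    = form K (lsubmx v *m A) + form K' (rsubmx v *m A').
  by rewrite -form_block -{1}[v]hsubmxK mul_row_block !mulmx0 addr0 add0r.
have form0 m (L : 'M[C]_m) : form L 0 = 0 by rewrite /form !mul0mx mxE.
exists (block_mx P 0 0 P'), (block_mx N 0 0 N'); split.
- move: Nfree Nfree'; rewrite /row_free rank_diag_block_mx.
  by move=> /eqP-> /eqP->.
- move=> v; rewrite formM; set v1 := lsubmx v; set v2 := rsubmx v => nzv.
  have [v10|/Ppos pos1] := eqVneq v1 0; have [v20|/Ppos' pos2] := eqVneq v2 0.
  + by move: nzv; rewrite -[v]hsubmxK -/v1 -/v2 v10 v20 row_mx0 eqxx.
  + by rewrite v10 mul0mx form0 add0r.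
  + by rewrite v20 mul0mx form0 addr0.
  + exact: addr_gt0.
- by move=> v; rewrite formM -oppr_ge0 opprD addr_ge0 ?oppr_ge0.
Qed.

Lemma form_scalar c (w : 'rV[C]_1) : form c%:M w = c * (w 0 0 * (w 0 0)^*).
Proof.
rewrite /form mul_mx_scalar -scalemxAl mxE; congr (_ * _).
by rewrite [w]mx11_scalar tr_scalar_mx map_scalar_mx -scalar_mxM !mxE eqxx !mulr1n.
Qed.

Lemma inertia_cert_pos : inertia_cert (1%:M : 'M[C]_1) 1 0.
Proof.
exists 1%:M, 0; split=> [|v nzv|v].
- by rewrite /row_free mxrank0.
- rewrite mulmx1 form_scalar mul1r mul_conjC_gt0.
  by apply: contraNneq nzv => v0; rewrite [v]mx11_scalar v0 raddf0.
- by rewrite mulmx0 /form !mul0mx mxE.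
Qed.

Lemma inertia_cert_nonpos n (K : 'M[C]_n) :
  (forall w, form K w <= 0) -> inertia_cert K 0 n.
Proof.
move=> Kneg; exists 0, 1%:M; split=> [|v|v] //.
- by rewrite row_free_unit unitmx1.
- by rewrite [v]thinmx0 eqxx.
Qed.

(** * Invariants of the individual summands *)

Lemma scalar11_eq (a b : C) : (a%:M == b%:M :> 'M_1) = (a == b).
Proof.
apply/eqP/eqP => [/matrixP/(_ 0 0)|-> //].
by rewrite !mxE eqxx !mulr1n.
Qed.

Lemma scalar11_eq0 (a : C) : (a%:M == 0 :> 'M_1) = (a == 0).
Proof. by rewrite -(scalar11_eq a 0) raddf0. Qed.

Lemma pair11_eq (a b c d : C) :
  (pair11 a b == pair11 c d) = (a == c) && (b == d).
Proof. by rewrite eq_Tagged /= xpair_eqE !scalar11_eq. Qed.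

Lemma pair11_GF (a b : C) : (pair11 a b == GFpair) = false.
Proof. by apply/eqP => /(congr1 ncols). Qed.

Lemma rank_scalar11 (a : C) : \rank (a%:M : 'M_1) = (a != 0).
Proof. by rewrite rank_rV scalar11_eq0. Qed.

Lemma pair11_invariants (a b : C) :
  [/\ rankE (pair11 a b) = (a != 0), rankQ (pair11 a b) = (b != 0),
      rankEQ (pair11 a b) = (a != 0) || (b != 0) &
      rankG (pair11 a b) = (a != 0) && (b != 0)].
Proof.
split; rewrite /rankE /rankQ /rankEQ /rankG ?rank_scalar11 //=.
  by rewrite -mxrank_tr rank_rV trmx_eq0 col_mx_eq0 !scalar11_eq0 negb_and.
rewrite /gram /= tr_scalar_mx map_scalar_mx -scalar_mxM rank_scalar11.
by rewrite mulf_eq0 conjC_eq0 negb_or.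
Qed.

Lemma GFpair_gram : gram GFpair = 0.
Proof.
rewrite GFpairE /gram /= trmx_delta map_delta_mx.
by rewrite mul_delta_mx_0.
Qed.

Lemma GFpair_invariants :
  [/\ rankE GFpair = 1, rankQ GFpair = 1, rankEQ GFpair = 1 & rankG GFpair = 0]%N.
Proof.
split; rewrite ?[rankG _]/rankG ?GFpair_gram ?mxrank0 //.
- by rewrite GFpairE /rankE mxrank_delta.
- by rewrite GFpairE /rankQ mxrank_delta.
rewrite GFpairE /rankEQ /=; apply/eqP; rewrite eqn_leq; apply/andP; split.
  (* Both blocks are a column times the same unit row, so the stack factors through dimension 1; its
     first block already has rank 1. *)
  rewrite -(mul_delta_mx (0 : 'I_1) (0 : 'I_2) (0 : 'I_2)).
  rewrite -(mul_delta_mx (0 : 'I_1) (1 : 'I_2) (0 : 'I_2)) -mul_col_mx.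
  exact: mulmx_max_rank.
rewrite -[X in (X <= _)%N](mxrank_delta C (0 : 'I_2) (0 : 'I_2)) mxrankS //.
by rewrite -addsmxE addsmxSl.
Qed.

(** Scaling by [mu^*] turns the Gram matrix into 1 for [(1, mu)], -1 for [(1, - mu)] and 0
    otherwise, so [(1, mu)] alone counts as positive. The subtraction does not truncate, as that
    summand has one column. *)
Lemma inertia_cert_summand (mu : C) (X : mxpair C) :
    mu * mu^* = 1 ->
    X \in summand_types [:: (1, mu); (1, - mu)] ->
  inertia_cert (mu^* *: gram X) (X == pair11 1 mu) (ncols X - (X == pair11 1 mu)).
Proof.
move=> mu1 XT.
have gram11 a b : mu^* *: gram (pair11 a b) = (mu^* * (a^* * b))%:M.
  rewrite /gram /= tr_scalar_mx map_scalar_mx -scalar_mxM.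
  by rewrite scale_scalar_mx.
have [->|nX] := eqVneq X (pair11 1 mu).
  rewrite gram11 conjC1 mul1r mulrC mu1; exact: inertia_cert_pos.
rewrite subn0; apply: inertia_cert_nonpos => w.
suff [c c_le0 gX] : exists2 c, c <= 0 & mu^* *: gram X = c%:M.
  rewrite gX /form mul_mx_scalar -scalemxAl mxE mulr_le0_ge0 // mxE sumr_ge0 //.
  by move=> i _; rewrite !mxE mul_conjC_ge0.
move: XT nX; rewrite !inE => /or4P[/eqP->|/eqP->|/eqP->|/or3P[]/eqP->].
- by exists 0; rewrite // gram11 !mulr0.
- by exists 0; rewrite // gram11 conjC0 mul0r mulr0.
- by exists 0; rewrite // gram11 !mulr0.
- by exists 0; rewrite // GFpair_gram scaler0 raddf0.
- by rewrite eqxx.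
by exists (-1); rewrite ?oppr_le0 ?ler01 // gram11 conjC1 mul1r mulrN mulrC mu1.
Qed.

Lemma inertia_cert_bigdsum (mu : C) (s : seq (mxpair C)) :
    mu * mu^* = 1 ->
    {subset s <= summand_types [:: (1, mu); (1, - mu)]} ->
  inertia_cert (mu^* *: gram (bigdsum s)) (\sum_(X <- s) (X == pair11 1 mu))
    (\sum_(X <- s) (ncols X - (X == pair11 1 mu))).
Proof.
move=> mu1; elim: s => [|X s IHs] sub.
  rewrite /bigdsum !big_nil; apply: inertia_cert_nonpos => w.
  by rewrite [w]thinmx0 /form !mul0mx mxE.
rewrite /bigdsum !big_cons gram_dsum scale_block_mx !scaler0.
apply: inertia_cert_block; first by apply: inertia_cert_summand; rewrite ?sub ?mem_head.
by apply: IHs => Y Ys; rewrite sub // in_cons Ys orbT.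
Qed.

Lemma equivalent_invariants n (E Q : 'M[C]_n) (X : mxpair C) :
  equivalent E Q X ->
  [/\ ncols X = n, rankE X = \rank E, rankQ X = \rank Q,
      rankEQ X = \rank (col_mx E Q) & rankG X = \rank (E ^t* *m Q)].
Proof.
move=> [U [T [V [R [UT VR <-]]]]].
have [uU uT] := mulmx1_unit UT; have [uV _] := mulmx1_unit VR.
have uTs : T ^t* \in unitmx by rewrite map_unitmx unitmx_tr.
have rV m (A : 'M[C]_(m, n)) : \rank (A *m V) = \rank A.
  by rewrite mxrankMfree ?row_free_unit.
have rU m p (A : 'M[C]_m) (B : 'M[C]_(m, p)) : A \in unitmx -> \rank (A *m B) = \rank B.
  by move=> uA; rewrite eqmxMfull ?row_full_unit.
split=> //.
- by rewrite /rankE /= rV rU.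
- by rewrite /rankQ /= rV rU.
- rewrite /rankEQ /= -mul_col_mx rV.
  have -> : col_mx (U *m E) (T ^t* *m Q) = block_mx U 0 0 (T ^t*) *m col_mx E Q.
    by rewrite mul_block_col !mul0mx addr0 add0r.
  rewrite rU // unitmxE det_ublock unitrM -!unitmxE uU; exact: uTs.
rewrite /rankG /gram /= !adjM -!mulmxA (mulmxA (U ^t*)) -adjM (mulmx1C UT).
rewrite adj1 mul1mx (mulmxA (E ^t*)) rU; last by rewrite map_unitmx unitmx_tr.
by rewrite rV.
Qed.

Lemma equivalent_inertia n (E Q : 'M[C]_n) (X : mxpair C) mu p q :
  equivalent E Q X -> inertia_cert (mu^* *: gram X) p q ->
  inertia_cert (mu^* *: (E ^t* *m Q)) p q.
Proof.
move=> [U [T [V [R [UT VR <-]]]]].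
have -> : gram (mkpair (U *m E *m V) (T ^t* *m Q *m V)) = V ^t* *m (E ^t* *m Q) *m V.
  rewrite /gram /= !adjM -!mulmxA (mulmxA (U ^t*)) -adjM (mulmx1C UT).
  by rewrite adj1 mul1mx.
by move=> cert; apply: (inertia_cert_congr VR); rewrite -scalemxAr -scalemxAl.
Qed.

(** * Multiplicities of the summands *)

Section Counting.
Context (mu : C) (n : nat) (E Q : 'M[C]_n) (mu1 : mu * mu^* = 1).
Let types := summand_types [:: (1, mu); (1, - mu)].

Local Notation "#[ s ] X" := (count_mem X s) (at level 10, X at level 9).

(** Each additive invariant is a linear equation in the six multiplicities. [GFpair] contributes 1
    to each of the ranks of [E], [Q] and [[E; Q]], 0 to that of [E^* Q], and 2 to [n]; [lia] solves
    the system. *)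
Lemma count_equations (s : seq (mxpair C)) :
  {subset s <= types} -> equivalent E Q (bigdsum s) ->
  [/\ #[s] (pair11 1 0) = \rank (col_mx E Q) - \rank Q,
      #[s] (pair11 0 1) = \rank (col_mx E Q) - \rank E,
      #[s] GFpair = \rank E + \rank Q - \rank (col_mx E Q) - \rank (E ^t* *m Q),
      #[s] (pair11 0 0) + #[s] GFpair = n - \rank (col_mx E Q) &
      #[s] (pair11 1 mu) + #[s] (pair11 1 (- mu)) = \rank (E ^t* *m Q)]%N.
Proof.
have nz_mu : mu != 0.
  by apply: contra_eq_neq mu1 => ->; rewrite mul0r eq_sym oner_neq0.
have GF_pair11 (a b : C) : (GFpair == pair11 a b) = false.
  by rewrite eq_sym; exact: pair11_GF.
have utypes : uniq [:: pair11 1 0; pair11 0 1; pair11 0 0; GFpair;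
                       pair11 1 mu; pair11 1 (- mu)].
  rewrite !cons_uniq !inE !pair11_eq !pair11_GF !GF_pair11 !oner_eq0.
  rewrite ![0 == 1]eq_sym !oner_eq0 ![0 == mu]eq_sym ![0 == - mu]eq_sym.
  by rewrite !oppr_eq0 (negPf nz_mu) [mu == - mu]eq_sym eqNr (negPf nz_mu) !andbF.
move=> sub eqv; have [] := equivalent_invariants eqv.
rewrite ncols_bigdsum rankE_bigdsum rankQ_bigdsum rankEQ_bigdsum rankG_bigdsum.
rewrite !(sum_by_values _ utypes sub) !big_cons !big_nil.
have inv := pair11_invariants.
have [-> -> -> ->] := inv 1 0; have [-> -> -> ->] := inv 0 1.
have [-> -> -> ->] := inv 0 0; have [-> -> -> ->] := inv 1 mu.
have [-> -> -> ->] := inv 1 (- mu); have [-> -> -> ->] := GFpair_invariants.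
rewrite oppr_eq0 nz_mu oner_eq0 eqxx /=.
have -> : ncols GFpair = 2%N by [].
have n11 (a b : C) : ncols (pair11 a b) = 1%N by [].
by rewrite !n11 => *; split; lia.
Qed.

(** The positive subspace of [s] is played against the nonpositive one of [s']: with [p] and [p']
    the two counts and [q] the dimension of the latter, [p + q <= n = q + p']. *)
Lemma count_positive_leq (s s' : seq (mxpair C)) :
  {subset s <= types} -> {subset s' <= types} ->
  equivalent E Q (bigdsum s) -> equivalent E Q (bigdsum s') ->
  (count_mem (pair11 1 mu) s <= count_mem (pair11 1 mu) s')%N.
Proof.
move=> sub sub' eqv eqv'.
have cert := equivalent_inertia eqv (inertia_cert_bigdsum mu1 sub).
have cert' := equivalent_inertia eqv' (inertia_cert_bigdsum mu1 sub').
have := inertia_cert_leq cert cert'.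
have countE r : (\sum_(X <- r) (X == pair11 1%R mu) = count_mem (pair11 1%R mu) r)%N.
  by rewrite -sum1_count [RHS]big_mkcond; apply: eq_bigr => X _ /=; case: eqP.
rewrite countE; set q := (X in (_ + X <= _)%N).
have <- : (q + count_mem (pair11 1%R mu) s' = n)%N.
  rewrite -countE /q -big_split /=.
  have [nE _ _ _ _] := equivalent_invariants eqv'.
  rewrite -[RHS]nE ncols_bigdsum; apply: eq_bigr => X _.
  by rewrite subnK //; case: eqP => // ->.
by rewrite addnC leq_add2l.
Qed.

Lemma canonical_form_unique (s s' : seq (mxpair C)) :
  {subset s <= types} -> {subset s' <= types} ->
  equivalent E Q (bigdsum s) -> equivalent E Q (bigdsum s') -> perm_eq s s'.
Proof.
move=> sub sub' eqv eqv'.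
have eq_mu : #[s] (pair11 1 mu) = #[s'] (pair11 1 mu).
  apply/eqP; rewrite eqn_leq (count_positive_leq sub sub' eqv eqv').
  exact: count_positive_leq sub' sub eqv' eqv.
have [e1 e2 e3 e4 e5] := count_equations sub eqv.
have [f1 f2 f3 f4 f5] := count_equations sub' eqv'.
have eq_GF : #[s] GFpair = #[s'] GFpair by rewrite e3 f3.
(* [perm_eq] compares counts over the entries of [s ++ s'] only, and all of these lie in [types]. *)
apply/allP => X; rewrite mem_cat => XT.
have {XT} : X \in types by case/orP: XT => [/sub|/sub'].
rewrite !inE => /or4P[/eqP->|/eqP->|/eqP->|/or3P[]/eqP->]; apply/eqP.
- by rewrite e1 f1.
- by rewrite e2 f2.
- rewrite -[LHS](addnK (#[s] GFpair)) -[RHS](addnK (#[s'] GFpair)).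
  by rewrite e4 f4 eq_GF.
- exact: eq_GF.
- exact: eq_mu.
rewrite -[LHS](addKn (#[s] (pair11 1 mu))) -[RHS](addKn (#[s'] (pair11 1 mu))).
by rewrite e5 f5 eq_mu.
Qed.

Lemma full_rank_summands (s : seq (mxpair C)) :
  {subset s <= types} -> equivalent E Q (bigdsum s) ->
  \rank (col_mx E Q) = n -> pair11 0 0 \notin s /\ GFpair \notin s.
Proof.
move=> sub eqv rk; have [_ _ _ + _] := count_equations sub eqv.
rewrite rk subnn => /eqP; rewrite addn_eq0 => /andP[c00 cGF].
by split; rewrite -has_pred1 has_count -eqn0Ngt.
Qed.

End Counting.

(** If [n] columns span dimension [n], they are free; a row [u] with [u A^T = 0] is a linear
    relation among them. *)
Lemma colspan_rank m n (A : 'M[C]_(m, n)) :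
  \dim (colspan A) = n -> \rank A = n.
Proof.
move=> dimA; pose X := [tuple col j A | j < n].
have XE : colspan A = <<X>>%VS by [].
have : free X by rewrite /free -XE dimA size_tuple.
move/freeP => freeX; apply/eqP; rewrite -mxrank_tr; apply: inj_row_free => u uA.
apply/rowP => j; rewrite mxE; apply: (freeX (fun j => u 0 j)).
transitivity (A *m u^T); last by rewrite -[A]trmxK -trmx_mul uA trmx0.
apply/colP => i; rewrite summxE mxE; apply: eq_bigr => k _.
by rewrite (nth_map k) ?size_enum_ord // nth_ord_enum !mxE mulrC.
Qed.

End Uniqueness.

(** * The canonical form in all three cases *)

Theorem theorem3p15 (R : realType) (n : nat) (n_gt0 : (0 < n)%N)
    (E Q : 'M[R[i]]_n)
    (hEQ : E ^t* *m Q \is hermsymmx \/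
           E ^t* *m Q \is hermitianmx n true Num.conj) :
  forall MN : seq (R[i] * R[i]), MN_set (E ^t* *m Q) MN ->
  [/\ exists s, canonical_decomp MN E Q s,
      forall s s', canonical_decomp MN E Q s -> canonical_decomp MN E Q s' ->
        perm_eq s s' &
      lagrangian (colspan (col_mx E Q)) ->
        forall s, canonical_decomp MN E Q s ->
        {subset s <= [:: pair11 1 0; pair11 0 1] ++ MN_summands MN}].
Proof.
clear hEQ => MN MN_EQ.
(* Common normal form of the cases: [mu = 1] and [K = E^* Q] if Hermitian or positive semidefinite,
   [mu = i] and [K = - i E^* Q] if skew-Hermitian. *)
have [mu [K [[mu1 hK EQ] [MNp MNn subMN]]]] : exists mu (K : 'M[R[i]]_n),
    [/\ mu * mu^* = 1, K ^t* = K & E ^t* *m Q = mu *: K] /\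
    [/\ (1, mu) \in MN,
      (1, - mu) \in MN \/ (forall x : 'cV_n, 0 <= (x ^t* *m K *m x) 0 0)
      & {subset MN <= [:: (1, mu); (1, - mu)]}].
  case: MN_EQ => [hH|[hH psd]|hH]; have /is_hermitianmxP := hH.
  - rewrite expr0 scale1r => {}hH; exists 1, (E ^t* *m Q).
    rewrite conjC1 mulr1 scale1r !inE !eqxx orbT; do !split=> //.
    by left.
  - rewrite expr0 scale1r => {}hH; exists 1, (E ^t* *m Q).
    rewrite conjC1 mulr1 scale1r !inE !eqxx; do !split=> //.
      by right.
    by move=> x; rewrite !inE => ->.
  rewrite expr1 scaleN1r => {}hH; exists 'i, (- 'i *: (E ^t* *m Q)).
  rewrite adjZ rmorphN /= conjCi mulrN -expr2 sqrCi opprK scalerA mulrN -expr2 sqrCi.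
  rewrite !opprK scale1r !inE !eqxx orbT; do !split=> //.
    by rewrite [in RHS]hH scalerN scaleNr opprK.
  by left.
(* Uniqueness for the single value [(1, 1)] is thus an instance of uniqueness with both signs. *)
have sub_types (s : seq (mxpair R[i])) : {subset s <= summand_types MN} ->
    {subset s <= summand_types [:: (1, mu); (1, - mu)]}.
  move=> sub X /sub; rewrite !mem_cat => /orP[->//|/mapP[p /subMN pMN ->]].
  by apply/orP; right; apply/mapP; exists p.
split.
- have [s sub eqv] := canonical_form_exists mu1 hK EQ MNp MNn.
  exists s; split=> //; last exact/equivalentP.
  (* An empty list of summands would have 0 columns, whereas [n > 0]. *)
  rewrite lt0n size_eq0; apply: contraTneq n_gt0 => s0.
  have [nE _ _ _ _] := equivalent_invariants eqv.
  by rewrite -nE s0 ncols_bigdsum big_nil.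
- move=> s s' [_ /sub_types sub /equivalentP eqv] [_ /sub_types sub' /equivalentP eqv'].
  exact: (canonical_form_unique mu1 sub sub' eqv eqv').
move=> [dimS _] s [_ sub /equivalentP eqv] X Xs.
have [no00 noGF] := full_rank_summands mu1 (sub_types _ sub) eqv (colspan_rank dimS).
have := sub X Xs; rewrite !mem_cat => /orP[|->]; last by rewrite orbT.
rewrite !inE => /or4P[/eqP->|/eqP->|/eqP eX|/eqP eX].
- by rewrite eqxx.
- by rewrite eqxx orbT.
- by move: no00; rewrite -eX Xs.
- by move: noGF; rewrite -eX Xs.
Qed.
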